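(* Let $K$ be a field, let $\alpha,\beta,\gamma$ be integers with $1\le\alpha\le\beta\le\gamma\le2(\alpha+\beta)$ such that $\alpha+\beta+\gamma$ is divisible by three, and let $t=\frac13(\alpha+\beta+\gamma)$. Consider the ideal $$I=(x^{\alpha+t},y^{\beta+t},z^{\gamma+t},x^\alpha y^\beta z^\gamma)\subset R=K[x,y,z].$$ Then $R/I$ has the weak Lefschetz property if $\operatorname{char}K=0$ or $\operatorname{char}K\ge\alpha+\beta+\gamma$.
   Context: $R=K[x,y,z]$ carries the standard grading. A standard graded Artinian $K$-algebra $A$ has the weak Lefschetz property if there is a linear form $\ell\in [A]_1$ such that, for all integers $d$, the multiplication map $\times\ell:[A]_d\to[A]_{d+1}$ has maximal rank, that is, it is injective or surjective. *)

(* Defs.v *)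
From HB Require Import structures.
From mathcomp Require Import all_boot all_algebra.
From mathcomp Require Import boolp.
From mathcomp Require Import mpoly.

Set Implicit Arguments.
Unset Strict Implicit.
Unset Printing Implicit Defensive.

Import GRing.Theory.
Local Open Scope ring_scope.
Local Open Scope quotient_scope.

Section GeneratedIdeal.
Variable R : comNzRingType.

Definition in_ideal (gens : seq R) (f : R) : Prop :=
  exists c : nat -> R, f = \sum_(i < size gens) c i * gens`_i.

(* [ring_quotient] wants ideals as boolean predicates, hence [asbool]. *)
Definition ideal_gen (gens : seq R) : pred R := fun f => `[< in_ideal gens f >].

Lemma ideal_genP (gens : seq R) (f : R) :
  reflect (in_ideal gens f) (f \in ideal_gen gens).
Proof. exact: asboolP. Qed.

Lemma ideal_gen_closed (gens : seq R) :
  1 \notin ideal_gen gens -> idealr_closed (ideal_gen gens).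
Proof.
move=> n1; split=> //.
  apply/ideal_genP; exists (fun=> 0).
  by rewrite big1 // => i _; rewrite mul0r.
move=> a u v /ideal_genP[c ->] /ideal_genP[d ->].
apply/ideal_genP; exists (fun i => a * c i + d i).
rewrite mulr_sumr -big_split /=; apply: eq_bigr => i _.
by rewrite mulrDl mulrA.
Qed.

(* Rings of type [comNzRingType] are nonzero, so the quotient needs a proof
   that the ideal is proper. *)
Definition ideal_of (gens : seq R) (n1 : 1 \notin ideal_gen gens) : idealr R :=
  HB.pack (ideal_gen gens)
    (isIdealr.Build R (ideal_gen gens) (ideal_gen_closed n1)).

Definition quotient_ring (gens : seq R) (n1 : 1 \notin ideal_gen gens)
  : comNzRingType := {ideal_quot (ideal_of n1)}.

Definition quotient_proj (gens : seq R) (n1 : 1 \notin ideal_gen gens)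
  (f : R) : quotient_ring n1 := \pi_({ideal_quot (ideal_of n1)}) f.

Lemma quotient_proj_eq (gens : seq R) (n1 : 1 \notin ideal_gen gens) (f g : R) :
  quotient_proj n1 f = quotient_proj n1 g <-> in_ideal gens (f - g).
Proof.
have h : (f - g \in ideal_gen gens) = (quotient_proj n1 f == quotient_proj n1 g).
  exact: (Quotient.idealrBE (ideal_of n1) f g).
split=> [e|/ideal_genP]; last by rewrite h => /eqP.
by apply/ideal_genP; rewrite h e.
Qed.

Lemma quotient_proj_mul (gens : seq R) (n1 : 1 \notin ideal_gen gens) :
  {morph quotient_proj n1 : f g / f * g}.
Proof. exact: rmorphM. Qed.

Lemma quotient_proj_surj (gens : seq R) (n1 : 1 \notin ideal_gen gens)
  (a : quotient_ring n1) : exists f, a = quotient_proj n1 f.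
Proof. by exists (repr a); rewrite /quotient_proj reprK. Qed.

End GeneratedIdeal.

(* [gr d] is the degree-d component [A]_d; the components of negative degree
   are zero and impose no condition. *)
Definition has_WLP (A : comNzRingType) (gr : nat -> A -> Prop) : Prop :=
  exists2 l : A, gr 1%N l &
    forall d : nat,
      (forall a b : A, gr d a -> gr d b -> l * a = l * b -> a = b) \/
      (forall b : A, gr d.+1 b -> exists2 a : A, gr d a & l * a = b).

(* The grading R/I inherits from the standard grading of R: [R/I]_d is the
   image of [R]_d. *)
Definition quotient_gr (n : nat) (K : fieldType) (gens : seq {mpoly K[n]})
  (n1 : 1 \notin ideal_gen gens) (d : nat) (a : quotient_ring n1) : Prop :=
  exists2 f : {mpoly K[n]}, f \is d.-homog & a = quotient_proj n1 f.

Section Generators.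
Variable K : fieldType.

Definition varx : {mpoly K[3]} := 'X_(@Ordinal 3 0 isT).
Definition vary : {mpoly K[3]} := 'X_(@Ordinal 3 1 isT).
Definition varz : {mpoly K[3]} := 'X_(@Ordinal 3 2 isT).

Definition aci_gens (a b c t : nat) : seq {mpoly K[3]} :=
  [:: varx ^+ (a + t); vary ^+ (b + t); varz ^+ (c + t);
      varx ^+ a * vary ^+ b * varz ^+ c].

Lemma aci_proper (a b c t : nat) :
  (1 <= a)%N -> (a <= b)%N -> (b <= c)%N ->
  1 \notin ideal_gen (aci_gens a b c t).
Proof.
move=> a1 ab bc; apply/negP => /ideal_genP[c' /(congr1 (meval (fun=> 0)))].
have b1 := leq_trans a1 ab; have c1 := leq_trans b1 bc.
have p0 m : (0 < m)%N -> (0 : K) ^+ m = 0 by case: m => // m _; rewrite expr0n.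
rewrite !big_ord_recl big_ord0 /= /varx /vary /varz.
rewrite !(rmorphD, rmorphM, rmorphXn, rmorph0, rmorph1) /= !mevalXU.
rewrite !p0 ?addn_gt0 ?a1 ?b1 ?c1 // !(mulr0, mul0r, addr0).
by move/eqP; rewrite oner_eq0.
Qed.

End Generators.

(* Main.v *)
From HB Require Import structures.
Require Import Defs.
From mathcomp Require Import all_boot all_algebra.
From mathcomp Require Import mpoly zify ring.

Set Implicit Arguments.
Unset Strict Implicit.
Unset Printing Implicit Defensive.

Import GRing.Theory.
Local Open Scope ring_scope.

(* Take l = x + y - z. Below degree 3t the generator x^alpha y^beta z^gamma
   plays no role, and modulo l a form of degree n becomes a univariate
   polynomial of degree <= n through x -> X, y -> 1, z -> 1 + X. With
   A = 2t - alpha, B = 2t - beta, C = 2t - gamma one has A + B + C = 3t, and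
   the three generators become X^(B+C), 1 and (1+X)^(A+B). The key point is
   that X^(B+C) u + v + (1+X)^(A+B) w = 0 with deg u < A, deg v < B, deg w < C
   forces u = v = w = 0: the B-th derivative kills v, and the B-th derivatives
   of the two other terms are opposite, hence divisible by X^C (1+X)^A while
   of degree < A + C, so they vanish; as all exponents are below 3t <= char K,
   both terms have degree < B, which is only possible for u = w = 0.
   This independence gives injectivity of l up to degree 3t - 1, and the
   resulting spanning statement (by dimension) gives surjectivity onto the
   degrees >= 3t. *)

(** * Univariate independence and spanning for [X^(B+C)], [1] and [(1+X)^(A+B)] *)

Section BinaryForms.
Variable K : fieldType.
Implicit Types p q u v w : {poly K}.

Lemma dvdp_deriv_exp p q k : p ^+ k.+1 %| q -> p ^+ k %| q^`().
Proof.
case/dvdpP => s ->; rewrite derivM deriv_exp /= exprS.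
by rewrite dvdp_add // ?mulrA -?mulrnAl ?mulrA dvdp_mulIr.
Qed.

Lemma dvdp_derivn_exp p q k n : p ^+ k %| q -> p ^+ (k - n) %| q^`(n).
Proof.
move=> pq; elim: n => [|n IHn]; first by rewrite subn0.
rewrite derivnS; have [kn|nk] := leqP k n.
  by rewrite (eqnP (leqW kn)) expr0 dvd1p.
by apply: dvdp_deriv_exp; rewrite -subSn.
Qed.

(** The n-th derivative multiplies the coefficient of [X^j] by [j (j-1) ... (j-n+1)], whose factors
    are all invertible when [n <= j < N]. *)
Lemma size_derivn_eq0 N n q : (forall k, (0 < k < N)%N -> k%:R != 0 :> K) ->
  (size q <= N)%N -> q^`(n) = 0 -> (size q <= n)%N.
Proof.
move=> charK szq q0; apply/leq_sizeP => j nj.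
have [Nj|jN] := leqP N j; first by rewrite nth_default // (leq_trans szq).
have := coef_derivn n q (j - n); rewrite q0 coef0 subnKC // => /esym/eqP.
rewrite -mulr_natr mulf_eq0 ffact_prod natr_prod => /orP[/eqP //|].
suff /negPf-> : \prod_(i < n) (j - i)%:R != 0 :> K by [].
by apply/prodf_neq0 => i _; apply: charK; have := ltn_ord i; lia.
Qed.

Lemma size_exp_addX1 n : size ((1 + 'X : {poly K}) ^+ n) = n.+1.
Proof. by rewrite addrC -[1]opprK -polyCN size_exp_XsubC. Qed.

Variables A B C : nat.
Hypothesis charK : forall k, (0 < k < A + B + C)%N -> k%:R != 0 :> K.

Lemma binary_independent u v w :
  (size u <= A)%N -> (size v <= B)%N -> (size w <= C)%N ->
  'X^(B + C) * u + v + (1 + 'X) ^+ (A + B) * w = 0 -> [/\ u = 0, v = 0 & w = 0].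
Proof.
move=> su sv sw uvw.
have X1_neq0 n : (1 + 'X : {poly K}) ^+ n != 0.
  by rewrite -size_poly_gt0 size_exp_addX1.
have su' : (size ('X^(B + C) * u)%R <= A + B + C)%N.
  by rewrite (leq_trans (size_polyMleq _ _)) // size_polyXn; lia.
have sw' : (size ((1 + 'X) ^+ (A + B) * w)%R <= A + B + C)%N.
  by rewrite (leq_trans (size_polyMleq _ _)) // size_exp_addX1; lia.
set F := 'X^(B + C) * u in uvw su'; set G := (1 + 'X) ^+ (A + B) * w in uvw sw'.
have FG : F^`(B) = - G^`(B).
  apply/eqP; rewrite -addr_eq0; apply/eqP.
  move: (congr1 (derivn B) uvw).
  by rewrite !derivnD (derivn_poly0 sv) addr0 derivnC if_same.
have dF : 'X^C %| F^`(B).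
  by rewrite -[C](addKn B); apply/dvdp_derivn_exp/dvdp_mulIl.
have dG : (1 + 'X) ^+ A %| F^`(B).
  by rewrite FG dvdpNr -[A](addnK B); apply/dvdp_derivn_exp/dvdp_mulIl.
have F0 : F^`(B) = 0.
  apply: contraTeq (leqnn (A + C).+1) => F_neq0; rewrite -ltnNge ltnS.
  have cop : coprimep ('X^C) ((1 + 'X : {poly K}) ^+ A).
    apply/coprimep_expl/coprimep_expr.
    by rewrite coprimep_sym coprimepX rootE !hornerE oner_eq0.
  have dFG : 'X^C * (1 + 'X) ^+ A %| F^`(B) by rewrite Gauss_dvdp // dF.
  have sF : (size F^`(B) <= A + C)%N.
    apply/leq_sizeP => j Aj.
    by rewrite coef_derivn nth_default ?mul0rn ?(leq_trans su') //; lia.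
  have := leq_trans (dvdp_leq F_neq0 dFG) sF.
  rewrite size_mul ?X1_neq0 ?monic_neq0 ?monicXn // size_polyXn size_exp_addX1.
  by rewrite addnS addSn addnC.
have G0 : G^`(B) = 0 by apply/eqP; rewrite -oppr_eq0 -FG F0.
have /(size_derivn_eq0 charK su') := F0; have /(size_derivn_eq0 charK sw') := G0.
(* A nonzero [w] would give [G] size at least [A + B + 1]. *)
have w0 : (size G <= B)%N -> w = 0.
  apply: contraTeq => w0; rewrite /G size_mul // size_exp_addX1 addSn -ltnNge.
  rewrite -addnA -addn1 addnCA leq_add2l (leq_trans _ (leq_addl _ _)) //.
  by rewrite size_poly_gt0.
have u0 : (size F <= B)%N -> u = 0.
  apply: contraTeq => u0; rewrite /F size_mul // -?size_poly_eq0 size_polyXn //.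
  rewrite addSn -ltnNge -addnA -addn1 leq_add2l (leq_trans _ (leq_addl _ _)) //.
  by rewrite size_poly_gt0.
move=> /w0 w00 /u0 u00; split => //.
by move: uvw; rewrite /F /G u00 w00 !mulr0 add0r addr0.
Qed.

(** The combination is a linear endomorphism of a space of dimension [A + B + C], injective by
    [binary_independent], hence onto. *)
Lemma binary_span p : (size p <= A + B + C)%N ->
  exists u v w, [/\ (size u <= A)%N, (size v <= B)%N, (size w <= C)%N &
    p = 'X^(B + C) * u + v + (1 + 'X) ^+ (A + B) * w].
Proof.
move=> sp.
(* One row space encodes both the triples, as blocks of lengths [A], [B], [C], and the polynomials
   of size at most [A + B + C]. *)
pose T := 'rV[K]_(A + B + C).
pose U (r : T) := rVpoly (lsubmx (lsubmx r)).
pose V (r : T) := rVpoly (rsubmx (lsubmx r)).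
pose W (r : T) := rVpoly (rsubmx r).
pose P (r : T) : {poly K} := 'X^(B + C) * U r + V r + (1 + 'X) ^+ (A + B) * W r.
have sU r : (size (U r) <= A)%N by exact: size_poly.
have sV r : (size (V r) <= B)%N by exact: size_poly.
have sW r : (size (W r) <= C)%N by exact: size_poly.
have sP r : (size (P r) <= A + B + C)%N.
  rewrite !(leq_trans (size_polyD _ _)) // geq_max; apply/andP; split.
    rewrite (leq_trans (size_polyD _ _)) // geq_max (leq_trans (sV r)) ?andbT; last lia.
    by rewrite (leq_trans (size_polyMleq _ _)) // size_polyXn; have := sU r; lia.
  by rewrite (leq_trans (size_polyMleq _ _)) // size_exp_addX1; have := sW r; lia.
pose f (r : T) : T := poly_rV (P r).
have flin : linear f.
  move=> k r s; rewrite /f -linearP; congr poly_rV; rewrite /P /U /V /W !linearP /=.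
  by rewrite -!mul_polyC; ring.
pose fL : {linear T -> T} := HB.pack f (GRing.isLinear.Build K T T _ f flin).
have free : row_free (lin1_mx fL).
  apply: inj_row_free => r; rewrite mul_rV_lin1 => /(congr1 rVpoly).
  rewrite linear0 poly_rV_K //= => /(binary_independent (sU r) (sV r) (sW r)) [u0 v0 w0].
  rewrite -[r]hsubmxK -[lsubmx r]hsubmxK -[lsubmx (lsubmx r)]rVpolyK.
  rewrite -[rsubmx (lsubmx r)]rVpolyK -[rsubmx r]rVpolyK.
  by rewrite [rVpoly _]u0 [rVpoly _]v0 [rVpoly _]w0 !linear0 !row_mx0.
have unit : lin1_mx fL \in unitmx by rewrite -row_free_unit.
pose r := poly_rV p *m invmx (lin1_mx fL).
exists (U r), (V r), (W r); split=> //.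
have : fL r = poly_rV p by rewrite -mul_rV_lin1 mulmxKV.
by move/(congr1 rVpoly); rewrite !poly_rV_K.
Qed.
End BinaryForms.

(** * Homogeneous components of a product with a form *)

Section PihomogMul.
Variables (n : nat) (K : fieldType).
Implicit Types f g : {mpoly K[n]}.

(** Multiplication by [g] shifts each component of [f] by [e], so only the one of degree [d - e]
    contributes; the test [e <= d] guards against truncated subtraction. *)
Lemma pihomogMr d e f g : g \is e.-homog ->
  pihomog mdeg d (f * g) = if (e <= d)%N then pihomog mdeg (d - e) f * g else 0.
Proof.
move=> hg; have fE := pihomog_partitionE (leqnn (mmeasure mdeg f)).
set m := mmeasure mdeg f in fE.
rewrite {1}fE mulr_suml raddf_sum /=.
have hi i : pihomog mdeg d (pihomog mdeg i f * g) =
    if (i + e == d)%N then pihomog mdeg i f * g else 0.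
  have hf : pihomog mdeg i f * g \is (i + e).-homog.
    by apply: dhomogM => //; apply: pihomogP.
  have [<-|ned] := eqVneq (i + e)%N d; first by rewrite pihomog_dE.
  by rewrite (pihomog_ne0 ned).
under eq_bigr => i _ do rewrite hi.
have [ed|de] := leqP e d; last first.
  by rewrite big1 // => i _; rewrite (_ : (_ == _) = false) //; lia.
rewrite [in RHS]fE raddf_sum /= mulr_suml; apply: eq_bigr => i _.
have [<-|ne] := eqVneq (i + e)%N d; first by rewrite addnK pihomog_id.
rewrite (@pihomog_ne0 _ _ _ i) ?mul0r //; first lia.
exact: pihomogP.
Qed.

End PihomogMul.

(** * Reduction of ternary forms modulo the linear form [ell] *)

Section Dehomogenization.
Variable K : fieldType.
Local Notation x := (varx K).
Local Notation y := (vary K).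
Local Notation z := (varz K).
Implicit Types (f g : {mpoly K[3]}) (p : {poly K}).

Definition ell : {mpoly K[3]} := x + y - z.

Definition dehom : {mpoly K[3]} -> {poly K} :=
  mmap polyC (fun i : 'I_3 => [:: 'X; 1; 1 + 'X]`_i).

HB.instance Definition _ := GRing.RMorphism.on dehom.

Lemma dehomZ c f : dehom (c *: f) = c *: dehom f.
Proof. by rewrite /dehom mmapZ mul_polyC. Qed.

Lemma dehom_varx : dehom x = 'X.
Proof. by rewrite /dehom /varx mmapX mmap1U. Qed.
Lemma dehom_vary : dehom y = 1.
Proof. by rewrite /dehom /vary mmapX mmap1U. Qed.
Lemma dehom_varz : dehom z = 1 + 'X.
Proof. by rewrite /dehom /varz mmapX mmap1U. Qed.
Definition dehom_var := (dehom_varx, dehom_vary, dehom_varz).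

Lemma dehom_ell : dehom ell = 0.
Proof. by rewrite /ell rmorphB rmorphD /= !dehom_var; ring. Qed.

Lemma varx_homog : x \is 1.-homog. Proof. by rewrite dhomogX /= mdeg1. Qed.
Lemma vary_homog : y \is 1.-homog. Proof. by rewrite dhomogX /= mdeg1. Qed.
Lemma varz_homog : z \is 1.-homog. Proof. by rewrite dhomogX /= mdeg1. Qed.

Lemma varX_homog n :
  [/\ x ^+ n \is n.-homog, y ^+ n \is n.-homog & z ^+ n \is n.-homog].
Proof.
by split; rewrite -[X in X.-homog]mul1n; apply: dhomogMn;
  [apply: varx_homog|apply: vary_homog|apply: varz_homog].
Qed.

Lemma ell_homog : ell \is 1.-homog.
Proof. by rewrite rpredB ?rpredD ?varx_homog ?vary_homog ?varz_homog. Qed.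

Lemma ell_neq0 : ell != 0.
Proof.
(* Evaluation at [(1, 0, 0)], where [ell] takes the value 1. *)
apply/eqP => /(congr1 (meval (fun i : 'I_3 => (i == 0)%:R))) /eqP.
rewrite rmorphB rmorphD rmorph0 /= !mevalXU /=.
by rewrite addr0 subr0 oner_eq0.
Qed.

(** A section of [dehom] that avoids [z]. Coefficients above [n] are dropped, which keeps it linear
    on all of [{poly K}]. *)
Definition homogenize n p : {mpoly K[3]} :=
  \sum_(i < n.+1) p`_i *: (x ^+ i * y ^+ (n - i)).

Lemma homogenize_is_linear n : linear (homogenize n).
Proof.
move=> c p q; rewrite /homogenize scaler_sumr -big_split /=.
by apply: eq_bigr => i _; rewrite coefD coefZ scalerDl scalerA.
Qed.

HB.instance Definition _ n := GRing.isLinear.Build K {poly K} {mpoly K[3]} _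
  (homogenize n) (@homogenize_is_linear n).

Lemma homogenize_homog n p : homogenize n p \is n.-homog.
Proof.
apply: rpred_sum => i _; apply: rpredZ.
have [hx _ _] := varX_homog i; have [_ hy _] := varX_homog (n - i).
by have := dhomogM hx hy; rewrite subnKC // -ltnS.
Qed.

Lemma homogenizeK n p : (size p <= n.+1)%N -> dehom (homogenize n p) = p.
Proof.
move=> sp; rewrite /homogenize raddf_sum /=.
under eq_bigr do rewrite dehomZ rmorphM !rmorphXn /= !dehom_var expr1n mulr1.
rewrite -poly_def; apply/polyP => i; rewrite coef_poly ltnS.
by have [//|ni] := leqP i n; rewrite nth_default // (leq_trans sp).
Qed.

Lemma homogenize_mulX n p :
  homogenize n.+1 ('X * p) = x * homogenize n p.
Proof.
rewrite /homogenize big_ord_recl coefXM scale0r add0r mulr_sumr.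
by apply: eq_bigr => i _; rewrite coefXM /= subSS exprS -scalerAr mulrA.
Qed.

Lemma homogenize_widen n p : (size p <= n.+1)%N ->
  homogenize n.+1 p = y * homogenize n p.
Proof.
move=> sp; rewrite /homogenize big_ord_recr /= [p`_n.+1]nth_default //.
rewrite scale0r addr0.
rewrite mulr_sumr; apply: eq_bigr => i _.
by rewrite subSn ?exprS -?scalerAr 1?mulrCA // -ltnS.
Qed.

(** The size bound belongs to the invariant because multiplication by [y] needs the coefficient of
    [X^(n+1)] to vanish. *)
Definition homog_mod_ell n f : Prop :=
  (size (dehom f) <= n.+1)%N /\ exists q, f = homogenize n (dehom f) + ell * q.

Lemma homog_mod_ell_mul_varx n f : homog_mod_ell n f -> homog_mod_ell n.+1 (x * f).
Proof.
move=> [sf [q fE]]; rewrite /homog_mod_ell rmorphM /= dehom_varx; split.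
  by rewrite (leq_trans (size_polyMleq _ _)) // size_polyX.
by exists (x * q); rewrite homogenize_mulX {1}fE; ring.
Qed.

Lemma homog_mod_ell_mul_vary n f : homog_mod_ell n f -> homog_mod_ell n.+1 (y * f).
Proof.
move=> [sf [q fE]]; rewrite /homog_mod_ell rmorphM /= dehom_vary mul1r.
split; first exact: leqW.
by exists (y * q); rewrite homogenize_widen // {1}fE; ring.
Qed.

Lemma homog_mod_ellD n f g :
  homog_mod_ell n f -> homog_mod_ell n g -> homog_mod_ell n (f + g).
Proof.
move=> [sf [q fE]] [sg [r gE]]; rewrite /homog_mod_ell rmorphD /=; split.
  by rewrite (leq_trans (size_polyD _ _)) // geq_max sf.
by exists (q + r); rewrite {1}fE {1}gE linearD /=; ring.
Qed.

Lemma homog_mod_ellZ n c f : homog_mod_ell n f -> homog_mod_ell n (c *: f).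
Proof.
move=> [sf [q fE]]; rewrite /homog_mod_ell dehomZ; split.
  exact: leq_trans (size_scale_leq _ _) sf.
by exists (c *: q); rewrite {1}fE linearZ /= scalerDr scalerAr.
Qed.

(** Since [z = x + y - ell], this follows from the other two variables, with a correction [- f] in
    the cofactor of [ell]. *)
Lemma homog_mod_ell_mul_varz n f : homog_mod_ell n f -> homog_mod_ell n.+1 (z * f).
Proof.
move=> hf; have [sxy [q xyE]] :=
  homog_mod_ellD (homog_mod_ell_mul_varx hf) (homog_mod_ell_mul_vary hf).
have zE : dehom (z * f) = dehom (x * f + y * f).
  by rewrite rmorphD !rmorphM /= !dehom_var; ring.
rewrite /homog_mod_ell zE; split=> //; exists (q - f).
by rewrite mulrBr addrA -xyE /ell; ring.
Qed.

Lemma homog_mod_ell_mulX n f (i : 'I_3) :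
  homog_mod_ell n f -> homog_mod_ell n.+1 ('X_i * f).
Proof.
case: i => [[|[|[|//]]] lt_i] hf; rewrite (bool_irrelevance lt_i isT).
- exact: homog_mod_ell_mul_varx.
- exact: homog_mod_ell_mul_vary.
- exact: homog_mod_ell_mul_varz.
Qed.

Lemma homog_mod_ell_mulXn n f (i : 'I_3) k :
  homog_mod_ell n f -> homog_mod_ell (k + n) ('X_i ^+ k * f).
Proof.
move=> hf; elim: k => [|k IHk]; first by rewrite mul1r.
by rewrite exprS -mulrA addSn; apply: homog_mod_ell_mulX.
Qed.

(** The invariant is stable under linear combinations, so monomials suffice, and these are built
    from 1 one variable at a time. *)
Lemma dhomog_mod_ell n f : f \is n.-homog -> homog_mod_ell n f.
Proof.
move=> /dhomogP hf; rewrite [f]mpolyE big_seq_cond.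
apply: big_ind => [|g h|m].
- rewrite /homog_mod_ell rmorph0 size_poly0; split=> //.
  by exists 0; rewrite linear0 mulr0 addr0.
- exact: homog_mod_ellD.
rewrite andbT => /hf <-; apply: homog_mod_ellZ.
rewrite mpolyXE_id /= mdegE !big_ord_recl !big_ord0.
do 3!apply: homog_mod_ell_mulXn.
rewrite /homog_mod_ell rmorph1 size_poly1; split=> //; exists 0.
by rewrite /homogenize big_ord1 coef1 scale1r mulr0 addr0 mulr1.
Qed.

Lemma size_dehom n f : f \is n.-homog -> (size (dehom f) <= n.+1)%N.
Proof. by case/dhomog_mod_ell. Qed.

(** The remainder [homogenize n (dehom f)] vanishes. This turns univariate identities back into
    divisibility by [ell]. *)
Lemma dhomog_dehom_eq0 n f : f \is n.-homog -> dehom f = 0 ->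
  exists q, f = ell * q.
Proof.
by move=> /dhomog_mod_ell[_ [q fE]] f0; exists q; rewrite fE f0 linear0 add0r.
Qed.

End Dehomogenization.

(** * Multiplication by [ell] modulo the four generators *)

Section AlmostCompleteIntersection.
Variable K : fieldType.
Local Notation x := (varx K).
Local Notation y := (vary K).
Local Notation z := (varz K).
Local Notation l := (ell K).
Implicit Types f g : {mpoly K[3]}.

Lemma in_aciP (a b c t : nat) f :
  in_ideal (aci_gens K a b c t) f <->
  exists p q r s, f = p * x ^+ (a + t) + q * y ^+ (b + t) + r * z ^+ (c + t)
                      + s * (x ^+ a * y ^+ b * z ^+ c).
Proof.
split=> [[h ->]|[p [q [r [s ->]]]]].
  exists (h 0), (h 1), (h 2), (h 3)%N.
  by rewrite !big_ord_recl big_ord0 /= !addrA addr0.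
exists (fun i => [:: p; q; r; s]`_i).
by rewrite !big_ord_recl big_ord0 /= !addrA addr0.
Qed.

(** For [e > n] the component is zero, which agrees with the truncated bound 0; otherwise the
    cofactor is the component of [f] of degree [n - e]. *)
Lemma pihomog_mul_cofactor n e f g : g \is e.-homog ->
  exists h k, [/\ h \is k.-homog, (size (dehom h) <= n.+1 - e)%N &
    pihomog mdeg n (f * g) = h * g].
Proof.
move=> hg; rewrite (pihomogMr _ _ hg); have [en|ne] := leqP e n.
  exists (pihomog mdeg (n - e) f), (n - e)%N; split=> //; first exact: pihomogP.
  by rewrite subSn // size_dehom // pihomogP.
exists 0, 0%N; rewrite mul0r; split=> //; first exact: dhomog0.
by rewrite rmorph0 size_poly0.
Qed.

Variables alpha beta gamma t : nat.
Hypothesis sum_exp : (alpha + beta + gamma = 3 * t)%N.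
Hypothesis le_exp : [/\ alpha <= 2 * t, beta <= 2 * t & gamma <= 2 * t]%N.
Hypothesis charK : forall k, (0 < k < 3 * t)%N -> k%:R != 0 :> K.
Local Notation I := (aci_gens K alpha beta gamma t).
Let A := (2 * t - alpha)%N.
Let B := (2 * t - beta)%N.
Let C := (2 * t - gamma)%N.

Let ABC : [/\ A + B + C = 3 * t, B + C = alpha + t & A + B = gamma + t]%N.
Proof. by case: le_exp => *; split; rewrite /A /B /C; lia. Qed.

Let charABC k : (0 < k < A + B + C)%N -> k%:R != 0 :> K.
Proof. by case: ABC => -> _ _; apply: charK. Qed.

Lemma mul_ell_inj d f : (d.+1 < 3 * t)%N -> f \is d.-homog ->
  in_ideal I (l * f) -> in_ideal I f.
Proof.
(* In degree [d + 1], the cofactor of a generator of degree [e + t] has size at most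
   [d + 2 - (e + t)]; as [d + 2 <= 3t], this meets the bounds [A], [B], [C]. *)
move=> dt; have le_cof e : (d.+2 - (e + t) <= 2 * t - e)%N by lia.
move=> hf /in_aciP[p [q [r [s lf]]]].
have hlf : l * f \is d.+1.-homog by apply: (dhomogM (ell_homog K) hf).
move: (congr1 (pihomog mdeg d.+1) lf); rewrite pihomog_dE // !raddfD /=.
have [hx _ _] := varX_homog K (alpha + t).
have [_ hy _] := varX_homog K (beta + t).
have [_ _ hz] := varX_homog K (gamma + t).
have hm : x ^+ alpha * y ^+ beta * z ^+ gamma \is (alpha + beta + gamma).-homog.
  have [hx' _ _] := varX_homog K alpha; have [_ hy' _] := varX_homog K beta.
  have [_ _ hz'] := varX_homog K gamma.
  exact: dhomogM (dhomogM hx' hy') hz'.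
rewrite (pihomogMr _ _ hm) sum_exp leqNgt dt /= addr0.
have [p' [k1 [hp sp ->]]] := pihomog_mul_cofactor d.+1 p hx.
have [q' [k2 [hq sq ->]]] := pihomog_mul_cofactor d.+1 q hy.
have [r' [k3 [hr sr ->]]] := pihomog_mul_cofactor d.+1 r hz.
move=> lfE; have [ABCE BCE ABE] := ABC.
have [||||p0 q0 r0] := binary_independent charABC (u := dehom p') (v := dehom q')
  (w := dehom r').
- exact: leq_trans sp (le_cof alpha).
- exact: leq_trans sq (le_cof beta).
- exact: leq_trans sr (le_cof gamma).
- move: (congr1 (@dehom K) lfE).
  rewrite !rmorphD !rmorphM !rmorphXn /= !dehom_var dehom_ell mul0r => E.
  rewrite BCE ABE [RHS]E expr1n mulr1.
  by rewrite ['X^_ * _]mulrC [_ * dehom r']mulrC.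
have [p'' pE] := dhomog_dehom_eq0 hp p0; have [q'' qE] := dhomog_dehom_eq0 hq q0.
have [r'' rE] := dhomog_dehom_eq0 hr r0.
(* All three cofactors are multiples of [ell], which is cancelled in the domain. *)
apply/in_aciP; exists p'', q'', r'', 0; apply: (mulfI (ell_neq0 K)).
by rewrite lfE pE qE rE; ring.
Qed.

Lemma mul_ell_surj d f : (3 * t <= d.+1)%N -> f \is d.+1.-homog ->
  exists2 g, g \is d.-homog & in_ideal I (l * g - f).
Proof.
move=> td hf; have [ABCE BCE ABE] := ABC; have [at2 bt2 ct2] := le_exp.
have sf := size_dehom hf; set F := dehom f in sf.
have [|u [v [w [su sv sw FE]]]] := binary_span charABC (p := take_poly (3 * t) F).
  by rewrite ABCE size_take_poly.
(* The part of [F] above degree [3t] is a multiple of [X^(3t) = X^(alpha+t) X^A], so it is absorbed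
   into the cofactor of [X^(alpha+t)]. *)
pose u' := u + drop_poly (3 * t) F * 'X^A.
have FE' : F = 'X^(alpha + t) * u' + v + (1 + 'X) ^+ (gamma + t) * w.
  have XE : 'X^(3 * t) = 'X^(alpha + t) * 'X^A :> {poly K}.
    by rewrite -ABCE -addnA BCE addnC exprD.
  by rewrite -[LHS](poly_take_drop (3 * t)) FE BCE ABE XE /u'; ring.
have su' : (size u' <= (d.+1 - (alpha + t)).+1)%N.
  rewrite (leq_trans (size_polyD _ _)) // geq_max (leq_trans su) /=;
    last by rewrite /A; lia.
  rewrite (leq_trans (size_polyMleq _ _)) // size_polyXn size_drop_poly addnS /=.
  apply: (@leq_trans (d.+2 - 3 * t + A)); last by rewrite /A; lia.
  by rewrite leq_add2r leq_sub2r.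
have sv' : (size v <= (d.+1 - (beta + t)).+1)%N.
  by rewrite (leq_trans sv) // /B; lia.
have sw' : (size w <= (d.+1 - (gamma + t)).+1)%N.
  by rewrite (leq_trans sw) // /C; lia.
have [hx _ _] := varX_homog K (alpha + t).
have [_ hy _] := varX_homog K (beta + t).
have [_ _ hz] := varX_homog K (gamma + t).
set n1 := (d.+1 - (alpha + t))%N in su'; set n2 := (d.+1 - (beta + t))%N in sv'.
set n3 := (d.+1 - (gamma + t))%N in sw'.
(* An element of the ideal with the same image under [dehom] as [f], so that [ell] divides
   [f - j]. *)
pose j := homogenize n1 u' * x ^+ (alpha + t) + homogenize n2 v * y ^+ (beta + t)
  + homogenize n3 w * z ^+ (gamma + t).
have hj : j \is d.+1.-homog.
  have homj m e g p : (m + e = d.+1)%N -> g \is e.-homog ->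
      homogenize m p * g \is d.+1.-homog.
    by move=> <- hg; apply: dhomogM => //; apply: homogenize_homog.
  by apply: rpredD; [apply: rpredD|];
    [apply: homj hx|apply: homj hy|apply: homj hz]; apply: subnK; lia.
have j0 : dehom (f - j) = 0.
  rewrite rmorphB !rmorphD !rmorphM !rmorphXn /= !dehom_var !homogenizeK // -/F.
  by rewrite {1}FE' expr1n; ring.
have [q qE] := dhomog_dehom_eq0 (rpredB hf hj) j0.
(* [q] need not be homogeneous, but [f - j] is a form of degree [d + 1], so the degree [d] component
   of [q] has the same product with [ell]. *)
exists (pihomog mdeg d q); first exact: pihomogP.
have -> : l * pihomog mdeg d q - f = - j.
  have := pihomogMr d.+1 q (ell_homog K).
  rewrite /= subn1 /= mulrC -qE pihomog_dE ?rpredB // mulrC => <-.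
  by ring.
apply/in_aciP; exists (- homogenize n1 u'), (- homogenize n2 v), (- homogenize n3 w), 0.
by rewrite /j; ring.
Qed.

End AlmostCompleteIntersection.

(** * The weak Lefschetz property of the quotient *)

Theorem corollary4p6 (K : fieldType) (alpha beta gamma t : nat)
  (h1a : (1 <= alpha)%N) (hab : (alpha <= beta)%N) (hbc : (beta <= gamma)%N)
  (hc : (gamma <= 2 * (alpha + beta))%N)
  (h3 : (3 %| alpha + beta + gamma)%N)
  (ht : t = ((alpha + beta + gamma) %/ 3)%N)
  (hK : [pchar K] =i pred0 \/
        exists2 p, p \in [pchar K] & (alpha + beta + gamma <= p)%N) :
  has_WLP (quotient_gr (n1 := aci_proper K t h1a hab hbc)).
Proof.
have sumE : (alpha + beta + gamma = 3 * t)%N by rewrite ht mulnC divnK.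
(* Adding [2 gamma] to both sides of [gamma <= 2 (alpha + beta)] gives [3 gamma <= 6 t]; the smaller
   exponents follow. *)
have le_exp : [/\ alpha <= 2 * t, beta <= 2 * t & gamma <= 2 * t]%N by split; lia.
have charK k : (0 < k < 3 * t)%N -> k%:R != 0 :> K.
  case/andP => k0 kt; case: hK => [/pcharf0P->|[p pK tp]]; first by rewrite -lt0n.
  by rewrite -(dvdn_pcharf pK) gtnNdvd // (leq_trans kt) // -sumE.
exists (quotient_proj _ (ell K)); first by exists (ell K); first exact: ell_homog.
move=> d; have [dt|td] := ltnP d.+1 (3 * t)%N; [left|right].
  move=> _ _ [f hf ->] [g hg ->]; rewrite -!quotient_proj_mul => /quotient_proj_eq.
  rewrite -mulrBr => lfg; apply/quotient_proj_eq.
  exact: (mul_ell_inj sumE le_exp charK dt (rpredB hf hg) lfg).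
move=> _ [f hf ->]; have [g hg lgf] := mul_ell_surj sumE le_exp charK td hf.
exists (quotient_proj _ g); first by exists g.
by rewrite -quotient_proj_mul; apply/quotient_proj_eq.
Qed.
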